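(* The functor $S\colon\mathbf{Inf}\to\mathbf{Top}$ given by $$S_0(X,\mathrm{Con}_X,\vdash_X)=(|X|,S_X),$$ and, for $r\colon(X,\mathrm{Con}_X,\vdash_X)\to(Y,\mathrm{Con}_Y,\vdash_Y)$, $$S_1(r)=|r|\colon|X|\to|Y|,\qquad |r|(J)=\{y\in Y\mid \exists J'\subseteq J \text{ finite with } J'\,r\,y\},$$ is a full embedding of $\mathbf{Inf}$ into $\mathbf{Top}$. Consequently, $E^{\mathbf{Top}}\circ S\colon\mathbf{Inf}\to\mathbf{Chu}(\mathbf{Set},\mathbf 2)$ is a strict Chu representation of $\mathbf{Inf}$ into $\mathbf{Chu}(\mathbf{Set},\mathbf 2)$.
   Context: Embeddings and representations: an embedding is a functor that is injective on objects and faithful; a representation is a full embedding; a Chu representation is a representation whose codomain is a Chu category; it is strict if it is injective on arrows. Information systems (in the sense of Schwichtenberg–Wainer): a triple $(X,\mathrm{Con}_X,\vdash_X)$, with $X$ a countable set of tokens, $\mathrm{Con}_X$ a nonempty set of finite subsets of $X$ and $\vdash_X\,\subseteq\mathrm{Con}_X\times X$, such that: $U\subseteq V\in\mathrm{Con}_X$ implies $U\in\mathrm{Con}_X$; $\{a\}\in\mathrm{Con}_X$ for all $a\in X$; $U\vdash_X a$ implies $U\cup\{a\}\in\mathrm{Con}_X$; $a\in U\in\mathrm{Con}_X$ implies $U\vdash_X a$; if $U,V\in\mathrm{Con}_X$, $U\vdash_X a$ for all $a\in V$, and $V\vdash_X b$, then $U\vdash_X b$. An ideal is a subset $J\subseteq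 X$ such that every finite subset of $J$ is in $\mathrm{Con}_X$, and if $U\subseteq J$ is finite and $U\vdash_X a$ then $a\in J$. $|X|$ is the set of ideals of $(X,\mathrm{Con}_X,\vdash_X)$, and $S_X$ is the Scott topology on $|X|$, with base the sets $\mathcal O_A=\{J\in|X|\mid A\subseteq J\}$, $A\in\mathrm{Con}_X$. $\mathbf{Inf}$ is the category of information systems with approximable mappings: a morphism $r\colon(X,\mathrm{Con}_X,\vdash_X)\to(Y,\mathrm{Con}_Y,\vdash_Y)$ is a relation $r\subseteq\mathrm{Con}_X\times Y$ such that: if $U\,r\,b_1,\dots,U\,r\,b_n$ then $\{b_1,\dots,b_n\}\in\mathrm{Con}_Y$; if $U\,r\,b_1,\dots,U\,r\,b_n$ and $\{b_1,\dots,b_n\}\vdash_Y b$ then $U\,r\,b$; if $U'\,r\,b$, $U\in\mathrm{Con}_X$ and $U\vdash_X a$ for all $a\in U'$, then $U\,r\,b$. Composition with $s\colon Y\to Z$: $A\,(s\circ r)\,z$ iff there is $B\in\mathrm{Con}_Y$ with $A\,r\,B$ (i.e. $A\,r\,b$ for all $b\in B$) and $B\,s\,z$. The identity of $(X,\mathrm{Con}_X,\vdash_X)$ is $\vdash_X$. $\mathbf{Top}$ is the category of topological spaces and continuous functions. Chu category: $\mathbf 2=\{0,1\}$. Objects of $\mathbf{Chu}(\mathbf{Set},\mathbf 2)$ are triplets $(A,f,B)$ with $A,B$ sets and $f\colon A\times B\to\mathbf 2$; a morphism $(A,f,B)\to(C,g,D)$ is a pair $(\phi^+,\phi^-)$ with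 $\phi^+\colon A\to C$, $\phi^-\colon D\to B$ and $f(a,\phi^-(d))=g(\phi^+(a),d)$ for all $a\in A$, $d\in D$; composition is $(\theta^+,\theta^-)\circ(\phi^+,\phi^-)=(\theta^+\circ\phi^+,\phi^-\circ\theta^-)$ and identities are $(\mathrm{id}_A,\mathrm{id}_B)$. The functor $E^{\mathbf{Top}}\colon\mathbf{Top}\to\mathbf{Chu}(\mathbf{Set},\mathbf 2)$ is $E^{\mathbf{Top}}_0(X,T)=(X,\in_{X,T},T)$, where $\in_{X,T}(x,G)=1$ if $x\in G$ and $0$ if $x\notin G$ (for $x\in X$, $G\in T$), and for continuous $f\colon(X,T)\to(Y,S)$, $E^{\mathbf{Top}}_1(f)=(f,f^{-1})$ with $f^{-1}\colon S\to T$, $U\mapsto f^{-1}(U)$. Reasoning here is classical. *)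

(* Defs.v *)
From HB Require Import structures.
From mathcomp Require Import all_boot.
From mathcomp Require Import boolp classical_sets functions cardinality.

Set Implicit Arguments.
Unset Strict Implicit.
Unset Printing Implicit Defensive.

Local Open Scope classical_set_scope.

(* Injectivity on objects of the functor [Scott] requires recovering the token
   set [X] from the set of ideals [|X|], so sets are compared by elements.  Equality of Rocq types
   does not support this, so all sets (including those underlying topological
   and Chu spaces) are taken in a universe [V] of extensional well-founded sets:
   iterative sets modulo bisimulation, an element of [V] being a bisimulation
   class.  On [V], Leibniz equality is extensional equality (lemma [extV]). *)

Inductive iset : Type := isup (A : Type) (f : A -> iset).

Fixpoint bisim (x y : iset) : Prop :=
  let: isup A f := x in let: isup B g := y in
  (forall a, exists b, bisim (f a) (g b)) /\
  (forall b, exists a, bisim (f a) (g b)).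

Lemma bisim_refl x : bisim x x.
Proof. by elim: x => A f IH /=; split=> a; exists a. Qed.

Lemma bisim_sym x y : bisim x y -> bisim y x.
Proof.
elim: x y => A f IH [B g] /= [fg gf]; split=> [b | a].
  by have [a /IH] := gf b; exists a.
by have [b /IH] := fg a; exists b.
Qed.

Lemma bisim_trans x y z : bisim x y -> bisim y z -> bisim x z.
Proof.
elim: x y z => A f IH [B g] [C h] /= [fg gf] [gh hg]; split=> [a | c].
  by have [b ab] := fg a; have [c bc] := gh b; exists c; apply: IH bc.
by have [b bc] := hg c; have [a ab] := gf b; exists a; apply: IH bc.
Qed.

Lemma sig_inj (T : Type) (P : T -> Prop) (u v : {x | P x}) :
  sval u = sval v -> u = v.
Proof. by move: u v => [x Px] [y Py] /= xy; apply: eq_exist. Qed.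

Definition V : Type := {P : set iset | exists x, P = bisim x}.

HB.instance Definition _ := gen_eqMixin V.

Definition classV (x : iset) : V := exist _ (bisim x) (ex_intro _ x erefl).

Definition reprV (u : V) : iset := projT1 (cid (svalP u)).

Lemma reprVK u : classV (reprV u) = u.
Proof. by apply: sig_inj; rewrite /reprV /=; case: cid. Qed.

Lemma classV_eq x y : bisim x y -> classV x = classV y.
Proof.
move=> xy; apply: sig_inj; apply/predeqP => z /=; split; last exact: bisim_trans.
exact/bisim_trans/bisim_sym.
Qed.

Lemma bisim_repr x : bisim (reprV (classV x)) x.
Proof.
have /(congr1 sval) /= E := reprVK (classV x).
by have := bisim_refl x; rewrite -{1}E.
Qed.

Definition branch (x : iset) : Type := let: isup A _ := x in A.
Definition member (x : iset) : branch x -> iset :=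
  let: isup A f as x := x return branch x -> iset in f.

Definition elts (u : V) : set V :=
  [set v | exists i, v = classV (@member (reprV u) i)].

Declare Scope V_scope.
Delimit Scope V_scope with V.
Notation "x ∈ A" := (elts A x) (at level 70, no associativity) : V_scope.
Notation "A ⊆ B" := (elts A `<=` elts B) (at level 70, no associativity) : V_scope.
Local Open Scope V_scope.

Lemma mem_classV x v : v ∈ classV x <-> exists i, v = classV (@member x i).
Proof.
rewrite /elts /=; move: (bisim_repr x); case: (reprV _) => A f; case: x => B g.
move=> /= [fg gf]; split=> -[i ->].
  by have [j ij] := fg i; exists j; apply: classV_eq.
by have [j ij] := gf i; exists j; apply/esym/classV_eq.
Qed.

Lemma extV (u v : V) : elts u = elts v -> u = v.
Proof.
rewrite -{2}(reprVK u) -{2}(reprVK v) => /predeqP E.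
have {}E w : w ∈ classV (reprV u) <-> w ∈ classV (reprV v) by rewrite !reprVK.
have eqV x y : classV x = classV y -> bisim x y.
  by move=> /(congr1 sval) /= ->; apply: bisim_refl.
apply: classV_eq; move: E; case: (reprV u) => A f; case: (reprV v) => B g E /=.
split=> i.
  by have /E/mem_classV[j /eqV] : classV (f i) ∈ classV (isup f)
    by [apply/mem_classV; exists i]; exists j.
have /E/mem_classV[j /eqV/bisim_sym] : classV (g i) ∈ classV (isup g).
  by apply/mem_classV; exists i.
by exists j.
Qed.

Definition pairV (u v : V) : V :=
  classV (isup (fun b : bool => if b then reprV u else reprV v)).

Definition sepV (u : V) (P : set V) : V :=
  classV (isup (fun i : {i : branch (reprV u) | P (classV (member i))} =>
    member (sval i))).

Definition bigcupV (u : V) : V :=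
  classV (isup (fun i : {i : branch (reprV u) & branch (member i)} =>
    member (projT2 i))).

Definition powV (u : V) : V :=
  classV (isup (fun P : branch (reprV u) -> Prop =>
    isup (fun i : {i | P i} => member (sval i)))).

Definition singV (u : V) : V := pairV u u.
Definition cupV (u v : V) : V := bigcupV (pairV u v).
Definition capV (u v : V) : V := sepV u (elts v).

Lemma mem_pairV u v w : w ∈ pairV u v <-> w = u \/ w = v.
Proof.
rewrite mem_classV; split=> [[[] /= ->] | [] ->]; rewrite ?reprVK; [by left|by right| |].
  by exists true; rewrite /= reprVK.
by exists false; rewrite /= reprVK.
Qed.

Lemma mem_sepV u P w : w ∈ sepV u P <-> w ∈ u /\ P w.
Proof.
rewrite mem_classV; split=> [[[i Pi] /= ->] | [[i ->] Pi]].
  by split=> //; exists i.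
by exists (exist _ i Pi).
Qed.

Lemma mem_bigcupV u w : w ∈ bigcupV u <-> exists2 v, v ∈ u & w ∈ v.
Proof.
rewrite mem_classV; split=> [[[i j] /= ->] | [_ [i ->] /mem_classV[j ->]]].
  by exists (classV (member i)); [exists i | apply/mem_classV; exists j].
by exists (existT _ i j).
Qed.

Lemma mem_powV u w : w ∈ powV u <-> w ⊆ u.
Proof.
rewrite mem_classV; split=> [[P /= ->] v /mem_classV[[i Pi] /= ->] | wu].
  by exists i.
exists (fun i => classV (member i) ∈ w); apply: extV; apply/predeqP => v.
rewrite mem_classV; split=> [vw | [[i iw] ->] //].
by have [i E] := wu _ vw; rewrite E in vw *; exists (exist _ i vw).
Qed.

Lemma mem_singV u w : w ∈ singV u <-> w = u.
Proof. by rewrite mem_pairV; split=> [[]|]; auto. Qed.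

Lemma mem_cupV u v w : w ∈ cupV u v <-> w ∈ u \/ w ∈ v.
Proof.
rewrite mem_bigcupV; split=> [[x /mem_pairV[] ->] | [] xw]; auto.
  by exists u => //; apply/mem_pairV; left.
by exists v => //; apply/mem_pairV; right.
Qed.

Lemma mem_capV u v w : w ∈ capV u v <-> w ∈ u /\ w ∈ v.
Proof. exact: mem_sepV. Qed.

Lemma elts_singV u : elts (singV u) = [set u].
Proof. by apply/predeqP => w; rewrite mem_singV. Qed.

Lemma elts_cupV u v : elts (cupV u v) = elts u `|` elts v.
Proof. by apply/predeqP => w; rewrite mem_cupV. Qed.

Definition finV (u : V) : Prop := finite_set (elts u).

Definition El (u : V) : Type := {x : V | x ∈ u}.

Record category : Type := Category {
  obj : Type;
  hom : obj -> obj -> Type;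
  idm : forall A, hom A A;
  compose : forall A B C, hom B C -> hom A B -> hom A C;
  comp_idl : forall A B (f : hom A B), compose (idm B) f = f;
  comp_idr : forall A B (f : hom A B), compose f (idm A) = f;
  comp_assoc : forall A B C D (h : hom C D) (g : hom B C) (f : hom A B),
    compose h (compose g f) = compose (compose h g) f }.

Record functor (C D : category) : Type := Functor {
  fobj : obj C -> obj D;
  fmap : forall A B, hom A B -> hom (fobj A) (fobj B);
  fmap_id : forall A, fmap (idm A) = idm (fobj A);
  fmap_comp : forall A B E (g : hom B E) (f : hom A B),
    fmap (compose g f) = compose (fmap g) (fmap f) }.

Arguments fmap {C D} _ {A B} _.

Section FunctorComp.
Variables (C D E : category) (G : functor D E) (F : functor C D).

Lemma functor_comp_id A :
  fmap G (fmap F (idm A)) = idm (fobj G (fobj F A)).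
Proof. by rewrite !fmap_id. Qed.

Lemma functor_comp_comp A B H (g : hom B H) (f : hom A B) :
  fmap G (fmap F (compose g f)) = compose (fmap G (fmap F g)) (fmap G (fmap F f)).
Proof. by rewrite !fmap_comp. Qed.

Definition functor_comp : functor C E :=
  Functor functor_comp_id functor_comp_comp.

End FunctorComp.

Definition injective_on_objects (C D : category) (F : functor C D) : Prop :=
  injective (fobj F).

Definition faithful (C D : category) (F : functor C D) : Prop :=
  forall A B : obj C, injective (fun f : hom A B => fmap F f).

Definition full (C D : category) (F : functor C D) : Prop :=
  forall (A B : obj C) (g : hom (fobj F A) (fobj F B)),
    exists f : hom A B, fmap F f = g.

Definition embedding (C D : category) (F : functor C D) : Prop :=
  injective_on_objects F /\ faithful F.

Definition full_embedding (C D : category) (F : functor C D) : Prop :=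
  embedding F /\ full F.

(* An arrow carries its domain and codomain, so that arrows belonging to
   different hom-sets can be compared. *)
Record arrow (C : category) : Type := Arrow {
  dom : obj C; cod : obj C; arr : hom dom cod }.

Definition fmap_arrow (C D : category) (F : functor C D) (u : arrow C) :
  arrow D := Arrow (fmap F (arr u)).

Definition injective_on_arrows (C D : category) (F : functor C D) : Prop :=
  injective (fmap_arrow F).

Record infsys : Type := InfSys {
  tok : V;
  Con : V;
  ent : V -> V -> Prop;
  tok_countable : countable (elts tok);
  Con_nonempty : elts Con !=set0;
  Con_finite : forall U, U ∈ Con -> U ⊆ tok /\ finV U;
  ent_dom : forall U a, ent U a -> U ∈ Con /\ a ∈ tok;
  Con_sub : forall U U', U ⊆ U' -> U' ∈ Con -> U ∈ Con;
  Con_sing : forall a, a ∈ tok -> singV a ∈ Con;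
  Con_ent : forall U a, ent U a -> cupV U (singV a) ∈ Con;
  ent_refl : forall U a, U ∈ Con -> a ∈ U -> ent U a;
  ent_trans : forall U U' b, U ∈ Con -> U' ∈ Con ->
    (forall a, a ∈ U' -> ent U a) -> ent U' b -> ent U b }.

(* The finite set [W] stands for [{b_1, ..., b_n}]; [n = 0] is included. *)
Record approx (X Y : infsys) : Type := Approx {
  arel : V -> V -> Prop;
  arel_dom : forall U b, arel U b -> U ∈ Con X /\ b ∈ tok Y;
  arel_con : forall U W, U ∈ Con X -> finV W ->
    (forall b, b ∈ W -> arel U b) -> W ∈ Con Y;
  arel_ent : forall U W b, U ∈ Con X -> finV W ->
    (forall b', b' ∈ W -> arel U b') -> ent Y W b -> arel U b;
  arel_mono : forall U' U b, arel U' b -> U ∈ Con X ->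
    (forall a, a ∈ U' -> ent X U a) -> arel U b }.

Arguments arel {X Y} _ _ _.

Lemma approx_eq X Y (r s : approx X Y) :
  (forall U b, arel r U b <-> arel s U b) -> r = s.
Proof.
case: r s => [r r1 r2 r3 r4] [s s1 s2 s3 s4] /= E.
have {}E : r = s by apply/funext => U; apply/predeqP => b; apply: E.
by subst s; f_equal; apply: Prop_irrelevance.
Qed.

Section ApproxId.
Variable X : infsys.

Lemma ent_con U W : U ∈ Con X -> finV W ->
  (forall b, b ∈ W -> ent X U b) -> W ∈ Con X.
Proof.
move=> UC /finite_seqP[s Ws] UW.
pose T (n : nat) := sepV W (fun b => b \in take n s).
suff T_con n : (cupV U (T n) ∈ Con X).
  apply: Con_sub (T_con (size s)) => b bW; apply/mem_cupV; right.
  by apply/mem_sepV; split=> //; rewrite take_size; rewrite Ws in bW.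
elim: n => [|n IH].
  by apply: Con_sub UC => b /mem_cupV[|/mem_sepV[_]]; rewrite ?take0.
have [sn|ns] := leqP (size s) n.
  apply: Con_sub IH => b /mem_cupV[bU|/mem_sepV[bW bs]]; apply/mem_cupV; first by left.
  by right; apply/mem_sepV; split=> //; move: bs; rewrite !take_oversize // leqW.
case: s Ws ns @T IH => // x0 s' Ws ns T IH.
set c := nth x0 (x0 :: s') n.
have cW : c ∈ W by rewrite Ws /=; apply: mem_nth.
have UTc : ent X (cupV U (T n)) c.
  apply: ent_trans (UW _ cW) => //.
  by move=> a aU; apply: ent_refl => //; apply/mem_cupV; left.
apply: Con_sub (Con_ent UTc) => b /mem_cupV[bU|/mem_sepV[bW bs]].
  by apply/mem_cupV; left; apply/mem_cupV; left.
move: bs; rewrite (take_nth x0) // mem_rcons inE => /orP[/eqP ->|bs].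
  by apply/mem_cupV; right; apply/mem_singV.
by apply/mem_cupV; left; apply/mem_cupV; right; apply/mem_sepV.
Qed.

Lemma ent_ent U W b : U ∈ Con X -> finV W ->
  (forall b', b' ∈ W -> ent X U b') -> ent X W b -> ent X U b.
Proof. by move=> UC finW UW Wb; apply: (ent_trans UC _ UW Wb); apply: ent_con UW. Qed.

Lemma ent_mono U' U b : ent X U' b -> U ∈ Con X ->
  (forall a, a ∈ U' -> ent X U a) -> ent X U b.
Proof. by move=> U'b UC UU'; have [U'C _] := ent_dom U'b; exact: ent_trans UU' U'b. Qed.

Definition approx_id : approx X X :=
  Approx (@ent_dom X) ent_con ent_ent ent_mono.

End ApproxId.

Section ApproxComp.
Variables (X Y Z : infsys) (s : approx Y Z) (r : approx X Y).

(* Composites are subsets of [Con X * tok Z]; [A ∈ Con X] has to be required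
   because it does not follow from the second clause when [B] is empty. *)
Definition comp_rel (A z : V) : Prop :=
  A ∈ Con X /\
  exists B, [/\ B ∈ Con Y, forall b, b ∈ B -> arel r A b & arel s B z].

Lemma comp_rel_dom U b : comp_rel U b -> U ∈ Con X /\ b ∈ tok Z.
Proof. by move=> [UC [B [_ _ /arel_dom[]]]]. Qed.

Lemma comp_rel_fin U W : U ∈ Con X -> finV W ->
  (forall z, z ∈ W -> comp_rel U z) ->
  exists B, [/\ B ∈ Con Y, forall b, b ∈ B -> arel r U b &
    forall z, z ∈ W -> arel s B z].
Proof.
move=> UC finW UW.
have [f fP] : {f : V -> V & forall z, z ∈ W ->
    [/\ f z ∈ Con Y, forall b, b ∈ f z -> arel r U b & arel s (f z) z]}.
  apply: (@choice _ _ (fun z B => z ∈ W -> [/\ B ∈ Con Y,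
    forall b, b ∈ B -> arel r U b & arel s B z])) => z.
  have [/UW[_ [B BP]]|zW] := pselect (z ∈ W); first by exists B.
  by exists z => /zW.
pose B := sepV (tok Y) (\bigcup_(z in elts W) elts (f z)).
have UB b : b ∈ B -> arel r U b.
  by move=> /mem_sepV[_ [z zW bz]]; have [_ + _] := fP _ zW; apply.
have BC : B ∈ Con Y.
  apply: (arel_con UC _ UB).
  apply: (@sub_finite_set _ _ (\bigcup_(z in elts W) elts (f z))).
    by move=> b /mem_sepV[].
  by apply: bigcup_finite => // z zW; have [/Con_finite[]] := fP _ zW.
exists B; split=> // z zW; have [fC Uf fz] := fP _ zW.
apply: (arel_mono fz BC) => b bf; apply: ent_refl => //.
by apply/mem_sepV; split; [case: (arel_dom (Uf _ bf)) | exists z].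
Qed.

Lemma comp_rel_con U W : U ∈ Con X -> finV W ->
  (forall z, z ∈ W -> comp_rel U z) -> W ∈ Con Z.
Proof.
by move=> UC finW /(comp_rel_fin UC finW)[B [BC _ BW]]; apply: arel_con BC finW BW.
Qed.

Lemma comp_rel_ent U W z : U ∈ Con X -> finV W ->
  (forall z', z' ∈ W -> comp_rel U z') -> ent Z W z -> comp_rel U z.
Proof.
move=> UC finW /(comp_rel_fin UC finW)[B [BC UB BW]] Wz; split=> //.
by exists B; split=> //; apply: arel_ent BC finW BW Wz.
Qed.

Lemma comp_rel_mono U' U z : comp_rel U' z -> U ∈ Con X ->
  (forall a, a ∈ U' -> ent X U a) -> comp_rel U z.
Proof.
move=> [U'C [B [BC U'B Bz]]] UC UU'; split=> //; exists B; split=> // b bB.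
exact: arel_mono (U'B _ bB) UC UU'.
Qed.

Definition approx_comp : approx X Z :=
  Approx comp_rel_dom comp_rel_con comp_rel_ent comp_rel_mono.

End ApproxComp.

Lemma approx_comp_idl X Y (r : approx X Y) : approx_comp (approx_id Y) r = r.
Proof.
apply: approx_eq => U b; split=> [[UC [B [BC UB Bb]]] | Ub].
  by apply: arel_ent UC _ UB Bb; case: (Con_finite BC).
have [UC bY] := arel_dom Ub; split=> //; exists (singV b); split.
- exact: Con_sing.
- by move=> c /mem_singV ->.
- by apply: ent_refl; [apply: Con_sing | apply/mem_singV].
Qed.

Lemma approx_comp_idr X Y (r : approx X Y) : approx_comp r (approx_id X) = r.
Proof.
apply: approx_eq => U b; split=> [[UC [B [BC UB Bb]]] | Ub].
  exact: arel_mono Bb UC UB.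
have [UC bY] := arel_dom Ub; split=> //; exists U; split=> // a aU.
exact: ent_refl.
Qed.

Lemma approx_comp_assoc X Y Z W (t : approx Z W) (s : approx Y Z)
    (r : approx X Y) :
  approx_comp t (approx_comp s r) = approx_comp (approx_comp t s) r.
Proof.
apply: approx_eq => U w; split=> [[UC [C [CC UsrC Cw]]] | [UC [B [BC UB]]]].
  have finC : finV C by case: (Con_finite CC).
  have [B [BC UB BsC]] := comp_rel_fin UC finC UsrC.
  by split=> //; exists B; split=> //; split=> //; exists C.
move=> [_ [C [CC BsC Cw]]]; split=> //; exists C; split=> // c cC.
by split=> //; exists B; split=> //; apply: BsC.
Qed.

Definition Inf : category :=
  Category approx_comp_idl approx_comp_idr approx_comp_assoc.

Record topspace : Type := TopSpace {
  carrier : V;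
  opens : V;
  opens_sub : forall G, G ∈ opens -> G ⊆ carrier;
  opens_carrier : carrier ∈ opens;
  opens_cap : forall G H, G ∈ opens -> H ∈ opens -> capV G H ∈ opens;
  opens_bigcup : forall F, F ⊆ opens -> bigcupV F ∈ opens }.

Definition preimageV (A B : V) (f : El A -> El B) (G : V) : V :=
  sepV A [set x | exists xA : x ∈ A, sval (f (exist _ x xA)) ∈ G].

Lemma mem_preimageV A B (f : El A -> El B) G (x : El A) :
  sval x ∈ preimageV f G <-> sval (f x) ∈ G.
Proof.
case: x => x xA /=; rewrite mem_sepV; split=> [[_ [xA' xG]] | xG].
  by rewrite (Prop_irrelevance xA xA').
by split=> //; exists xA.
Qed.

Lemma preimageV_sub A B (f : El A -> El B) G : preimageV f G ⊆ A.
Proof. by move=> x /mem_sepV[]. Qed.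

Lemma eq_subV A G H : G ⊆ A -> H ⊆ A ->
  (forall x : El A, sval x ∈ G <-> sval x ∈ H) -> G = H.
Proof.
move=> GA HA GH; apply: extV; apply/predeqP => x; split=> xG.
  exact/(GH (exist _ x (GA _ xG))).
exact/(GH (exist _ x (HA _ xG))).
Qed.

Lemma preimageV_id A G : G ⊆ A -> preimageV (@id (El A)) G = G.
Proof.
move=> GA; apply: (eq_subV (@preimageV_sub _ _ _ _) GA) => x.
exact: mem_preimageV.
Qed.

Lemma preimageV_comp A B C (g : El B -> El C) (f : El A -> El B) G :
  preimageV (fun x => g (f x)) G = preimageV f (preimageV g G).
Proof.
apply: (eq_subV (@preimageV_sub _ _ _ _) (@preimageV_sub _ _ _ _)) => x.
by rewrite !mem_preimageV.
Qed.

Definition continuousV (X Y : topspace) (f : El (carrier X) -> El (carrier Y)) :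
  Prop := forall G, G ∈ opens Y -> preimageV f G ∈ opens X.

Definition cmap (X Y : topspace) : Type :=
  {f : El (carrier X) -> El (carrier Y) | continuousV f}.

Lemma continuous_id X : @continuousV X X id.
Proof. by move=> G GX; rewrite preimageV_id //; apply: opens_sub. Qed.

Definition cmap_id (X : topspace) : cmap X X := exist _ id (@continuous_id X).

Lemma continuous_comp X Y Z (g : cmap Y Z) (f : cmap X Y) :
  @continuousV X Z (fun x => sval g (sval f x)).
Proof.
by move=> G GZ; rewrite preimageV_comp; apply: (svalP f); apply: (svalP g).
Qed.

Definition cmap_comp X Y Z (g : cmap Y Z) (f : cmap X Y) : cmap X Z :=
  exist _ (fun x => sval g (sval f x)) (continuous_comp g f).

Lemma cmap_comp_idl X Y (f : cmap X Y) : cmap_comp (cmap_id Y) f = f.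
Proof. exact: sig_inj. Qed.

Lemma cmap_comp_idr X Y (f : cmap X Y) : cmap_comp f (cmap_id X) = f.
Proof. exact: sig_inj. Qed.

Lemma cmap_comp_assoc X Y Z W (h : cmap Z W) (g : cmap Y Z) (f : cmap X Y) :
  cmap_comp h (cmap_comp g f) = cmap_comp (cmap_comp h g) f.
Proof. exact: sig_inj. Qed.

Definition Top : category :=
  Category cmap_comp_idl cmap_comp_idr cmap_comp_assoc.

Record chu_space : Type := ChuSpace {
  pos : V;
  neg : V;
  pairing : El pos * El neg -> bool }.

Record chu_map (P Q : chu_space) : Type := ChuMap {
  pos_map : El (pos P) -> El (pos Q);
  neg_map : El (neg Q) -> El (neg P);
  chu_adj : forall a d,
    pairing (a, neg_map d) = pairing (pos_map a, d) }.

Lemma chu_map_eq P Q (f g : chu_map P Q) :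
  pos_map f = pos_map g -> neg_map f = neg_map g -> f = g.
Proof.
case: f g => [fp fn fE] [gp gn gE] /= E1 E2; subst gp gn.
by f_equal; apply: Prop_irrelevance.
Qed.

Definition chu_id (P : chu_space) : chu_map P P :=
  @ChuMap P P id id (fun _ _ => erefl).

Lemma chu_comp_adj P Q R (g : chu_map Q R) (f : chu_map P Q) a d :
  pairing (a, neg_map f (neg_map g d)) = pairing (pos_map g (pos_map f a), d).
Proof. by rewrite !chu_adj. Qed.

Definition chu_comp P Q R (g : chu_map Q R) (f : chu_map P Q) : chu_map P R :=
  @ChuMap P R (fun a => pos_map g (pos_map f a))
    (fun d => neg_map f (neg_map g d)) (chu_comp_adj g f).

Lemma chu_comp_idl P Q (f : chu_map P Q) : chu_comp (chu_id Q) f = f.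
Proof. exact: chu_map_eq. Qed.

Lemma chu_comp_idr P Q (f : chu_map P Q) : chu_comp f (chu_id P) = f.
Proof. exact: chu_map_eq. Qed.

Lemma chu_comp_assoc P Q R T (h : chu_map R T) (g : chu_map Q R)
    (f : chu_map P Q) : chu_comp h (chu_comp g f) = chu_comp (chu_comp h g) f.
Proof. exact: chu_map_eq. Qed.

Definition Chu : category :=
  Category chu_comp_idl chu_comp_idr chu_comp_assoc.

Definition Chu_representation (C : category) (F : functor C Chu) : Prop :=
  full_embedding F.

Definition strict_Chu_representation (C : category) (F : functor C Chu) :
  Prop := Chu_representation F /\ injective_on_arrows F.

Definition ETop_obj (X : topspace) : chu_space :=
  @ChuSpace (carrier X) (opens X)
    (fun xG : El (carrier X) * El (opens X) => `[< sval xG.1 ∈ sval xG.2 >]).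

Definition ETop_neg X Y (f : cmap X Y) (G : El (opens Y)) : El (opens X) :=
  exist _ (preimageV (sval f) (sval G)) (svalP f _ (svalP G)).

Lemma ETop_adj X Y (f : cmap X Y) a d :
  @pairing (ETop_obj X) (a, ETop_neg f d) =
  @pairing (ETop_obj Y) (sval f a, d).
Proof. by apply: asbool_equiv_eq; apply: mem_preimageV. Qed.

Definition ETop_map X Y (f : cmap X Y) :
  chu_map (ETop_obj X) (ETop_obj Y) :=
  @ChuMap (ETop_obj X) (ETop_obj Y) (sval f) (ETop_neg f) (ETop_adj f).

Lemma ETop_id X : ETop_map (cmap_id X) = chu_id (ETop_obj X).
Proof.
apply: chu_map_eq => //; apply/funext => G; apply: sig_inj.
by apply: preimageV_id; apply: opens_sub (svalP G).
Qed.

Lemma ETop_comp X Y Z (g : cmap Y Z) (f : cmap X Y) :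
  ETop_map (cmap_comp g f) = chu_comp (ETop_map g) (ETop_map f).
Proof.
apply: chu_map_eq => //; apply/funext => G; apply: sig_inj.
exact: preimageV_comp.
Qed.

Definition ETop : functor Top Chu := @Functor Top Chu _ _ ETop_id ETop_comp.

Section Ideals.
Variable X : infsys.

Definition ideal (J : V) : Prop :=
  [/\ J ⊆ tok X,
      forall U, finV U -> U ⊆ J -> U ∈ Con X &
      forall U a, finV U -> U ⊆ J -> ent X U a -> a ∈ J].

Definition ideals : V := sepV (powV (tok X)) ideal.

Definition basic (A : V) : V := sepV ideals [set J | A ⊆ J].

Definition scott : V := sepV (powV ideals) [set G | forall J, J ∈ G ->
  exists A, [/\ A ∈ Con X, J ∈ basic A & basic A ⊆ G]].

Lemma idealsP J : J ∈ ideals <-> ideal J.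
Proof.
by rewrite mem_sepV mem_powV; split=> [[]|] //; move=> idJ; split=> //; case: idJ.
Qed.

Lemma scott_sub G : G ∈ scott -> G ⊆ ideals.
Proof. by move=> /mem_sepV[/mem_powV]. Qed.

Lemma scott_carrier : ideals ∈ scott.
Proof.
apply/mem_sepV; split=> [|J JX]; first exact/mem_powV.
have [U UC] := Con_nonempty X.
have nil0 w : ~ (w ∈ sepV U set0) by move=> /mem_sepV[].
exists (sepV U set0); split.
- by apply: Con_sub UC => w /nil0.
- by apply/mem_sepV; split=> // w /nil0.
- by move=> K /mem_sepV[].
Qed.

Lemma scott_cap G H : G ∈ scott -> H ∈ scott -> capV G H ∈ scott.
Proof.
move=> /mem_sepV[/mem_powV GX Gop] /mem_sepV[/mem_powV _ Hop].
apply/mem_sepV; split; first by apply/mem_powV => J /mem_capV[/GX].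
move=> J /mem_capV[/Gop[A [AC /mem_sepV[JX AJ] AG]]].
move=> /Hop[B [BC /mem_sepV[_ BJ] BH]].
have ABJ : cupV A B ⊆ J by move=> a /mem_cupV[/AJ|/BJ].
exists (cupV A B); split.
- have /idealsP[_ + _] := JX; apply=> //; rewrite /finV elts_cupV finite_setU.
  by have [_] := Con_finite AC; have [_] := Con_finite BC.
- by apply/mem_sepV.
- move=> K /mem_sepV[KX ABK]; apply/mem_capV; split.
    by apply: AG; apply/mem_sepV; split=> // a aA; apply: ABK; apply/mem_cupV; left.
  by apply: BH; apply/mem_sepV; split=> // a aB; apply: ABK; apply/mem_cupV; right.
Qed.

Lemma scott_bigcup F : F ⊆ scott -> bigcupV F ∈ scott.
Proof.
move=> Fop; apply/mem_sepV; split.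
  by apply/mem_powV => J /mem_bigcupV[G /Fop/scott_sub]; apply.
move=> J /mem_bigcupV[G GF JG].
have /mem_sepV[_ /(_ _ JG)[A [AC JA AG]]] := Fop _ GF.
by exists A; split=> // K /AG KG; apply/mem_bigcupV; exists G.
Qed.

Definition Scott_obj : topspace :=
  TopSpace scott_sub scott_carrier scott_cap scott_bigcup.

End Ideals.

Section IdealMap.
Variables (X Y : infsys) (r : approx X Y).

Definition image_ideal (J : V) : V := sepV (tok Y)
  [set y | exists J', [/\ finV J', J' ⊆ J & arel r J' y]].

Lemma mem_image_ideal J y : y ∈ image_ideal J <->
  exists J', [/\ finV J', J' ⊆ J & arel r J' y].
Proof.
rewrite mem_sepV; split=> [[] // | yJ]; split=> //.
by have [J' [_ _ /arel_dom[]]] := yJ.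
Qed.

Lemma image_ideal_fin J W : ideal X J -> finV W -> W ⊆ image_ideal J ->
  exists U, [/\ finV U, U ⊆ J, U ∈ Con X & forall b, b ∈ W -> arel r U b].
Proof.
move=> [JX JC _] finW WJ.
have [f fP] : {f : V -> V & forall b, b ∈ W ->
    [/\ finV (f b), f b ⊆ J & arel r (f b) b]}.
  apply: (@choice _ _ (fun b U => b ∈ W -> [/\ finV U, U ⊆ J & arel r U b])) => b.
  have [/WJ/mem_image_ideal[U UP]|bW] := pselect (b ∈ W); first by exists U.
  by exists b => /bW.
pose U := sepV J (\bigcup_(b in elts W) elts (f b)).
have finU : finV U.
  apply: (@sub_finite_set _ _ (\bigcup_(b in elts W) elts (f b))).
    by move=> b /mem_sepV[].
  by apply: bigcup_finite => // b bW; have [] := fP _ bW.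
have UJ : U ⊆ J by move=> a /mem_sepV[].
have UC : U ∈ Con X by apply: JC.
exists U; split=> // b bW; have [_ fJ fb] := fP _ bW.
apply: (arel_mono fb UC) => a af; apply: ent_refl => //; apply/mem_sepV.
by split; [apply: fJ | exists b].
Qed.

Lemma image_ideal_ideal J : ideal X J -> ideal Y (image_ideal J).
Proof.
move=> idJ; split=> [b /mem_sepV[] // | W finW WJ | W b finW WJ Wb].
  have [U [_ _ UC UW]] := image_ideal_fin idJ finW WJ.
  exact: arel_con UC finW UW.
have [U [finU UJ UC UW]] := image_ideal_fin idJ finW WJ.
by apply/mem_image_ideal; exists U; split=> //; apply: arel_ent UC finW UW Wb.
Qed.

Lemma image_ideal_mem (J : El (ideals X)) : image_ideal (sval J) ∈ ideals Y.
Proof. by apply/idealsP/image_ideal_ideal/idealsP; apply: svalP. Qed.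

Definition Scott_fun (J : El (ideals X)) : El (ideals Y) :=
  exist _ (image_ideal (sval J)) (image_ideal_mem J).

Lemma Scott_fun_continuous : @continuousV (Scott_obj X) (Scott_obj Y) Scott_fun.
Proof.
move=> G /mem_sepV[_ Gop]; apply/mem_sepV; split.
  by apply/mem_powV; apply: preimageV_sub.
move=> J /mem_sepV[JX [JX' /Gop[B [BC /mem_sepV[_ /= BJ] BG]]]].
have idJ : ideal X J by apply/idealsP.
have [U [finU UJ UC UB]] := image_ideal_fin idJ (Con_finite BC).2 BJ.
exists U; split=> //; first exact/mem_sepV.
move=> K /mem_sepV[KX UK].
apply/(mem_preimageV Scott_fun G (exist _ K KX)); apply: BG.
apply/mem_sepV; split; first exact: svalP.
by move=> b bB /=; apply/mem_image_ideal; exists U; split=> //; apply: UB.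
Qed.

Definition Scott_map : cmap (Scott_obj X) (Scott_obj Y) := exist _ Scott_fun Scott_fun_continuous.

End IdealMap.

Lemma Scott_id X : Scott_map (approx_id X) = cmap_id (Scott_obj X).
Proof.
apply: sig_inj; apply/funext => -[J JX]; apply: sig_inj; apply: extV => /=.
have [JtX JC Jent] : ideal X J by apply/idealsP.
apply/predeqP => a; rewrite mem_image_ideal; split=> [[U [finU UJ]] | aJ].
  exact: Jent.
have aX := JtX _ aJ; exists (singV a); split.
- by rewrite /finV elts_singV; apply: finite_set1.
- by move=> b /mem_singV ->.
- by apply: ent_refl; [apply: Con_sing | apply/mem_singV].
Qed.

Lemma Scott_comp X Y Z (s : approx Y Z) (r : approx X Y) :
  Scott_map (approx_comp s r) = cmap_comp (Scott_map s) (Scott_map r).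
Proof.
apply: sig_inj; apply/funext => -[J JX]; apply: sig_inj; apply: extV => /=.
have idJ : ideal X J by apply/idealsP.
apply/predeqP => z; rewrite !mem_image_ideal; split.
  move=> [U [finU UJ [UC [B [BC UB Bz]]]]]; exists B; split=> //.
    by case: (Con_finite BC).
  by move=> b /UB Ub; apply/mem_image_ideal; exists U.
move=> [B [finB BJ Bz]].
have [U [finU UJ UC UB]] := image_ideal_fin idJ finB BJ.
exists U; split=> //; split=> //; exists B; split=> //.
by case: (arel_dom Bz).
Qed.

Definition Scott : functor Inf Top := @Functor Inf Top _ _ Scott_id Scott_comp.

(* Main.v *)
From mathcomp Require Import all_boot.
From mathcomp Require Import boolp classical_sets.
Require Import Defs.

(** Everything rests on the ideals [closure U] generated by a consistent set
    [U].  Since [closure U] is the least ideal containing [U], the ideals alone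
    determine an information system: the tokens are the elements of ideals, the
    consistent sets are the finite subsets of ideals, and [U] entails [a]
    exactly when [a] lies in every ideal that contains [U].  Hence [Scott] is
    injective on objects ([ideals_inj]).

    On arrows, the two descriptions of a map are related, for consistent [U], by
    [U r b <-> b ∈ |r| (closure U)] ([arel_closure]).  This recovers [r] from
    [|r|], so [Scott] is faithful.  Read as a definition, it turns any continuous
    [f] into an approximable mapping.  That mapping induces [f] again because
    the value of a Scott-continuous function at an ideal [J] is the union of its
    values at the closures of the finite subsets of [J]
    ([mem_continuous_closure]); so [Scott] is full.

    [ETop] is a full embedding as well: the adjointness condition on a Chu map
    between spaces says precisely that its negative part is the inverse image
    under its positive part, which makes the positive part continuous.  Full
    embeddings compose, and an embedding is always injective on arrows, because
    injectivity on objects allows two arrows with equal images to be placed in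
    one hom-set, where faithfulness applies. *)

Set Implicit Arguments.
Unset Strict Implicit.
Unset Printing Implicit Defensive.

Local Open Scope classical_set_scope.
Local Open Scope V_scope.

(** * Embeddings of categories *)

(** Equal arrows have hom-set components that agree up to transport along any
    equalities of their endpoints; by proof irrelevance, the transport along
    reflexivity is the identity. *)
Lemma Arrow_inj (C : category) (A B : obj C) :
  injective (fun f : hom A B => Arrow f).
Proof.
move=> f g fg.
have transport (u v : arrow C) : u = v ->
    forall (eA : dom u = dom v) (eB : cod u = cod v),
    ecast A (hom A (cod v)) eA (ecast B (hom (dom u) B) eB (arr u)) = arr v.
  by move=> -> eA eB; rewrite (Prop_irrelevance eA erefl) (Prop_irrelevance eB erefl).
exact: (transport _ _ fg erefl erefl).
Qed.

Lemma embedding_injective_on_arrows (C D : category) (F : functor C D) :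
  embedding F -> injective_on_arrows F.
Proof.
move=> [Finj Ffaith] [A B f] [A' B' g] fg.
have AA' : A = A' by apply: Finj; apply: (congr1 (@dom D) fg).
have BB' : B = B' by apply: Finj; apply: (congr1 (@cod D) fg).
by subst A' B'; congr Arrow; apply/Ffaith/Arrow_inj.
Qed.

Lemma full_embedding_comp (C D E : category) (G : functor D E)
    (F : functor C D) :
  full_embedding G -> full_embedding F -> full_embedding (functor_comp G F).
Proof.
move=> [[Ginj Gfaith] Gfull] [[Finj Ffaith] Ffull]; split; first split.
- by move=> A B /Ginj/Finj.
- by move=> A B f g /Gfaith/Ffaith.
- move=> A B h; have [g <-] := Gfull _ _ h; have [f <-] := Ffull _ _ g.
  by exists f.
Qed.

(** * Topological spaces as Chu spaces *)

Lemma topspace_eq (X Y : topspace) :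
  carrier X = carrier Y -> opens X = opens Y -> X = Y.
Proof.
case: X Y => [X T X1 X2 X3 X4] [Y S Y1 Y2 Y3 Y4] /= XY TS; subst Y S.
by f_equal; apply: Prop_irrelevance.
Qed.

Lemma chu_map_neg (X Y : topspace) (h : chu_map (ETop_obj X) (ETop_obj Y))
    (G : El (opens Y)) :
  sval (neg_map h G) = preimageV (pos_map h) (sval G).
Proof.
apply: (@eq_subV (carrier X)).
- exact: opens_sub (svalP (neg_map h G)).
- exact: preimageV_sub.
move=> x; rewrite mem_preimageV.
exact: (asbool_eq_equiv (chu_adj h x G)).
Qed.

Lemma ETop_full_embedding : full_embedding ETop.
Proof.
split; first split.
- move=> X Y XY; apply: topspace_eq; first exact: (congr1 pos XY).
  exact: (congr1 neg XY).
- by move=> X Y f g fg; apply: sig_inj; apply: (congr1 (@pos_map _ _) fg).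
move=> X Y h.
have h_cont : @continuousV X Y (pos_map h).
  move=> G GY; rewrite -(chu_map_neg h (exist _ G GY)); exact: svalP.
exists (exist _ _ h_cont); apply: chu_map_eq => //; apply/funext => G.
by apply: sig_inj; exact/esym/chu_map_neg.
Qed.

(** * The ideals of an information system *)

Lemma sub_ideal_Con (X : infsys) (J U : V) :
  J ∈ ideals X -> finV U -> U ⊆ J -> U ∈ Con X.
Proof. by move=> /idealsP[_ + _]; apply. Qed.

Lemma basic_scott (X : infsys) A : A ∈ Con X -> basic X A ∈ scott X.
Proof.
move=> AC; apply/mem_sepV; split; first by apply/mem_powV => J /mem_sepV[].
by move=> J JA; exists A; split.
Qed.

Section Closure.
Variable X : infsys.

Definition closure (U : V) : V := sepV (tok X) (ent X U).

Lemma mem_closure U a : a ∈ closure U <-> ent X U a.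
Proof. by rewrite mem_sepV; split=> [[]|Ua] //; case: (ent_dom Ua). Qed.

Lemma sub_closure U : U ∈ Con X -> U ⊆ closure U.
Proof. by move=> UC a aU; apply/mem_closure/ent_refl. Qed.

Lemma closure_ideal U : U ∈ Con X -> closure U ∈ ideals X.
Proof.
move=> UC; apply/idealsP; split=> [a /mem_sepV[] // | W finW WU | W a finW WU Wa].
  by apply: (ent_con UC finW) => b /WU/mem_closure.
by apply/mem_closure; apply: (ent_ent UC finW) Wa => b /WU/mem_closure.
Qed.

Lemma closure_min U J : J ∈ ideals X -> finV U -> U ⊆ J -> closure U ⊆ J.
Proof. by move=> /idealsP[_ _ Jent] finU UJ a /mem_closure; apply: Jent. Qed.

Lemma tok_ideals a : a ∈ tok X <-> exists2 J, J ∈ ideals X & a ∈ J.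
Proof.
split=> [aX | [J /idealsP[JX _ _] /JX //]].
have aC := Con_sing aX; exists (closure (singV a)); first exact: closure_ideal.
by apply: sub_closure => //; apply/mem_singV.
Qed.

Lemma Con_ideals U :
  U ∈ Con X <-> finV U /\ exists2 J, J ∈ ideals X & U ⊆ J.
Proof.
split=> [UC | [finU [J JX UJ]]]; last exact: sub_ideal_Con JX finU UJ.
split; first by case: (Con_finite UC).
by exists (closure U); [apply: closure_ideal | apply: sub_closure].
Qed.

Lemma ent_ideals U a :
  ent X U a <-> U ∈ Con X /\ forall J, J ∈ ideals X -> U ⊆ J -> a ∈ J.
Proof.
split=> [Ua | [UC UJa]].
  have [UC _] := ent_dom Ua; split=> // J JX UJ.
  by apply: (closure_min JX _ UJ); [case: (Con_finite UC) | apply/mem_closure].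
by apply/mem_closure; apply: UJa; [apply: closure_ideal | apply: sub_closure].
Qed.


End Closure.

Lemma infsys_eq (X Y : infsys) : tok X = tok Y -> Con X = Con Y ->
  (forall U a, ent X U a <-> ent Y U a) -> X = Y.
Proof.
case: X Y => [X C e X1 X2 X3 X4 X5 X6 X7 X8 X9] [Y D e' Y1 Y2 Y3 Y4 Y5 Y6 Y7 Y8 Y9].
move=> /= XY CD E.
have {}E : e = e' by apply/funext => U; apply/predeqP => a; apply: E.
by subst Y D e'; f_equal; apply: Prop_irrelevance.
Qed.

Lemma ideals_inj : injective ideals.
Proof.
move=> X Y XY.
have CXY : Con X = Con Y.
  by apply: extV; apply/predeqP => U; rewrite !Con_ideals XY.
apply: infsys_eq => // [|U a]; last by rewrite !ent_ideals XY CXY.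
by apply: extV; apply/predeqP => a; rewrite !tok_ideals XY.
Qed.

(** * Approximable mappings and continuous functions *)

(** A witness [W ⊆ closure U] of [b ∈ |r| (closure U)] is entailed by [U], so the
    monotonicity of [r] moves it back to [U] itself. *)
Lemma arel_closure (X Y : infsys) (r : approx X Y) U b :
  arel r U b <-> U ∈ Con X /\ b ∈ image_ideal r (closure X U).
Proof.
rewrite mem_image_ideal; split=> [Ub | [UC [W [_ WU Wb]]]].
  have [UC _] := arel_dom Ub; split=> //; exists U; split=> //.
    by case: (Con_finite UC).
  exact: sub_closure.
by apply: arel_mono Wb UC _ => a /WU/mem_closure.
Qed.

Section Continuous.
Variables (X Y : infsys) (f : cmap (Scott_obj X) (Scott_obj Y)).

Definition closureEl U (UC : U ∈ Con X) : El (ideals X) :=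
  exist _ (closure X U) (closure_ideal UC).

(** The set of ideals [K] with [b ∈ f K] is the inverse image of the basic open
    set of [singV b], so around each of its members [J] it contains a basic
    neighbourhood, of some [U ⊆ J]; and [closure U] lies in that
    neighbourhood. *)
Lemma continuous_nbhs (J : El (ideals X)) b : b ∈ sval (sval f J) ->
  exists U, [/\ U ∈ Con X, U ⊆ sval J &
    forall K : El (ideals X), U ⊆ sval K -> b ∈ sval (sval f K)].
Proof.
move=> bJ; have bY : b ∈ tok Y.
  by apply/tok_ideals; exists (sval (sval f J)); first exact: svalP.
have /(svalP f)/mem_sepV[_ fop] := basic_scott (Con_sing bY).
have mem_f (K : El (ideals X)) :
    sval K ∈ preimageV (sval f) (basic Y (singV b)) <-> b ∈ sval (sval f K).
  rewrite mem_preimageV mem_sepV; split=> [[_] | bK]; first by apply; apply/mem_singV.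
  by split=> [|_ /mem_singV -> //]; exact: svalP.
have /mem_f/fop[U [UC /mem_sepV[_ UJ] Uf]] := bJ.
exists U; split=> // K UK; apply/mem_f/Uf/mem_sepV; split=> //; exact: svalP.
Qed.

Lemma continuous_mono (J K : El (ideals X)) :
  sval J ⊆ sval K -> sval (sval f J) ⊆ sval (sval f K).
Proof.
by move=> JK b /continuous_nbhs[U [_ UJ]]; apply=> a /UJ/JK.
Qed.

Lemma mem_continuous_closure (J : El (ideals X)) b : b ∈ sval (sval f J) <->
  exists U (UC : U ∈ Con X), U ⊆ sval J /\ b ∈ sval (sval f (closureEl UC)).
Proof.
split=> [/continuous_nbhs[U [UC UJ Uf]] | [U [UC [UJ]]]].
  by exists U, UC; split=> //; apply: Uf; apply: sub_closure.
apply: continuous_mono; apply: closure_min UJ; first exact: svalP.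
by case: (Con_finite UC).
Qed.

(** [closureEl] needs a proof of consistency, which is quantified here instead of
    being an argument because [approx] asks for a relation on all of [V]. *)
Definition continuous_rel (U b : V) : Prop :=
  exists UC : U ∈ Con X, b ∈ sval (sval f (closureEl UC)).

Lemma continuous_relE U (UC : U ∈ Con X) b :
  continuous_rel U b <-> b ∈ sval (sval f (closureEl UC)).
Proof.
split=> [[UC'] | bU]; last by exists UC.
by rewrite (Prop_irrelevance UC' UC).
Qed.

Lemma continuous_rel_dom U b : continuous_rel U b -> U ∈ Con X /\ b ∈ tok Y.
Proof.
move=> [UC bU]; split=> //; apply/tok_ideals.
by exists (sval (sval f (closureEl UC))); first exact: svalP.
Qed.

Lemma continuous_rel_con U W : U ∈ Con X -> finV W ->
  (forall b, b ∈ W -> continuous_rel U b) -> W ∈ Con Y.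
Proof.
move=> UC finW UW; apply: sub_ideal_Con (svalP (sval f (closureEl UC))) finW _.
by move=> b /UW/(continuous_relE UC).
Qed.

Lemma continuous_rel_ent U W b : U ∈ Con X -> finV W ->
  (forall b', b' ∈ W -> continuous_rel U b') -> ent Y W b ->
  continuous_rel U b.
Proof.
move=> UC finW UW Wb; apply/(continuous_relE UC).
apply: (closure_min (svalP (sval f (closureEl UC))) finW); last exact/mem_closure.
by move=> b' /UW/(continuous_relE UC).
Qed.

Lemma continuous_rel_mono U' U b : continuous_rel U' b -> U ∈ Con X ->
  (forall a, a ∈ U' -> ent X U a) -> continuous_rel U b.
Proof.
move=> [U'C bU'] UC UU'; exists UC; apply: continuous_mono bU'.
apply: closure_min; first exact: closure_ideal.
  by case: (Con_finite U'C).
by move=> a /UU'/mem_closure.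
Qed.

Definition continuous_approx : approx X Y :=
  Approx continuous_rel_dom continuous_rel_con continuous_rel_ent
    continuous_rel_mono.

Lemma Scott_continuous_approx : Scott_map continuous_approx = f.
Proof.
apply: sig_inj; apply/funext => J; apply: sig_inj; apply: extV.
apply/predeqP => b; rewrite mem_image_ideal mem_continuous_closure.
split=> [[U [_ UJ [UC bU]]] | [U [UC [UJ bU]]]]; first by exists U, UC.
by exists U; split=> //; [case: (Con_finite UC) | exists UC].
Qed.

End Continuous.

Lemma Scott_full_embedding : full_embedding Scott.
Proof.
split; first split.
- by move=> X Y /(congr1 carrier)/ideals_inj.
- move=> X Y r s rs; apply: approx_eq => U b; rewrite !arel_closure.
  split=> -[UC bU]; split=> //;
    have /(congr1 (fun h : cmap (Scott_obj X) (Scott_obj Y) =>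
      sval (sval h (closureEl UC)))) /= E := rs.
    by rewrite -E.
  by rewrite E.
- by move=> X Y f; exists (continuous_approx f); apply: Scott_continuous_approx.
Qed.

Theorem proposition4p3 :
  full_embedding Scott /\ strict_Chu_representation (functor_comp ETop Scott).
Proof.
have ES := full_embedding_comp ETop_full_embedding Scott_full_embedding.
split; first exact: Scott_full_embedding.
by split=> //; apply: embedding_injective_on_arrows; case: ES.
Qed.
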